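(* Let $a, b > 0$, $c \in \mathbb{R}$, $\alpha > 0$ and $\lambda > 0$ be constants. Let $H \ge 0$ denote semantic entropy, $C$ the (real-valued) evidence capacity, $Q$ a query, and $H_{\text{pref}}(C,Q)$ the preferred entropy, which does not depend on $H$. Let $\sigma(z) = 1/(1+e^{-z})$, let $$p_{\text{hall}}(H, C) = \sigma\big(a(H - H_{\text{pref}}(C,Q)) - bC + c\big),$$ and let $$\mathcal{L}_{\text{total}}(H \mid C, Q) = \alpha\,\big(H - H_{\text{pref}}(C,Q)\big)^2 + \lambda\, p_{\text{hall}}(H, C).$$ If $\alpha > \lambda a^2/8$, then $\mathcal{L}_{\text{total}}(H \mid C, Q)$ is strictly convex in $H$, admits a unique global minimizer $H^*(C,Q)$, and gradient descent converges from any initialization.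
   Context: A language model answers a query $Q$ given evidence $E$. Semantic entropy $H \ge 0$ is the model's uncertainty over semantically distinct answers to $(Q,E)$. Evidence capacity $C$ measures how informative the evidence $E$ is about the answer; it is a real number and may be negative (low or negative capacity indicates weak or misleading evidence). The preferred entropy $H_{\text{pref}}(C,Q)$ is the entropy level that would be optimal for task performance alone. The quantity $p_{\text{hall}}(H,C)$ is the modelled probability of hallucination. The objective $\mathcal{L}_{\text{total}}(H \mid C, Q)$ balances task performance against hallucination risk: $\alpha$ controls the preference for staying near the task-optimal entropy and $\lambda$ scales the hallucination penalty. The statement regards $\mathcal{L}_{\text{total}}$ as a function of the single variable $H$, with $C$ and $Q$ fixed; gradient descent is gradient descent on this function of $H$. *)

(* Defs.v *)
From Stdlib Require Import Reals.
From Coquelicot Require Import Coquelicot.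
Open Scope R_scope.

Definition sigmoid (z : R) : R := 1 / (1 + exp (- z)).

Section Objective.
Variables (Query : Type) (Hpref : R -> Query -> R) (a b c alpha lambda : R).

Definition p_hall (H C : R) (Q : Query) : R :=
  sigmoid (a * (H - Hpref C Q) - b * C + c).

Definition L_total (C : R) (Q : Query) (H : R) : R :=
  alpha * (H - Hpref C Q) ^ 2 + lambda * p_hall H C Q.
End Objective.

Arguments p_hall {Query} Hpref a b c H C Q.
Arguments L_total {Query} Hpref a b c alpha lambda C Q H.

Definition real_line : R -> Prop := fun _ => True.
Definition half_line : R -> Prop := fun x => 0 <= x.

(* Intended for convex D. *)
Definition strictly_convex_on (D : R -> Prop) (f : R -> R) : Prop :=
  forall x y t : R, D x -> D y -> x <> y -> 0 < t < 1 ->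
    f (t * x + (1 - t) * y) < t * f x + (1 - t) * f y.

Definition global_minimizer_on (D : R -> Prop) (f : R -> R) (x : R) : Prop :=
  D x /\ forall y : R, D y -> f x <= f y.

(* Gradient descent with constant step size eta, each step being followed by
   P: the identity for plain gradient descent on the line, and the projection
   [Rmax 0] onto half_line for (projected) gradient descent on that domain. *)
Fixpoint gradient_descent (P : R -> R) (f : R -> R) (eta x0 : R) (n : nat) : R :=
  match n with
  | O => x0
  | S m => let x := gradient_descent P f eta x0 m in P (x - eta * Derive f x)
  end.

(* Convergence to x for every sufficiently small constant step size, the
   threshold eta0 being independent of the initialization x0 in D. *)
Definition gradient_descent_converges
    (D : R -> Prop) (P : R -> R) (f : R -> R) (x : R) : Prop :=
  exists eta0 : R, 0 < eta0 /\
    forall eta x0 : R, 0 < eta < eta0 -> D x0 ->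
      is_lim_seq (gradient_descent P f eta x0) x.

(* Main.v *)
(* The logistic function s satisfies s'' = s (1 - s) (1 - 2 s), hence |s''| <= 1/4, and the second derivative of
   the objective lies between m = 2 alpha - lambda a^2 / 4 > 0 and M = 2 alpha + lambda a^2 / 4.  A function with
   0 < m <= f'' <= M lies strictly above its tangents, which gives strict convexity; its derivative has a zero z,
   and the projection of z onto the domain is the minimizer.  For a step size eta < 1 / M the map
   x |-> x - eta f'(x) is Lipschitz with constant 1 - eta m < 1, the projection is nonexpansive, and the minimizer
   is a fixed point of their composition, so gradient descent converges geometrically. *)
Require Import Defs.
From Stdlib Require Import Reals Lra.
From Coquelicot Require Import Coquelicot.
Open Scope R_scope.

(** * Strongly convex functions with bounded curvature *)

Section StronglyConvex.
Variables (f f' f'' : R -> R) (m M : R).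
Hypothesis f_derive : forall x, is_derive f x (f' x).
Hypothesis f'_derive : forall x, is_derive f' x (f'' x).
Hypothesis m_gt0 : 0 < m.
Hypothesis f''_bounds : forall x, m <= f'' x <= M.

Lemma derivative_growth x y :
  x <= y -> m * (y - x) <= f' y - f' x <= M * (y - x).
Proof.
intros Hxy.
destruct (MVT_gen f' x y f'') as [t [_ Ht]].
- intros t _; apply f'_derive.
- intros t _; apply continuity_pt_filterlim.
  apply (ex_derive_continuous f' t); now exists (f'' t).
- rewrite Ht; pose proof (f''_bounds t); nra.
Qed.

Lemma above_tangent x y : x <> y -> f x + f' x * (y - x) < f y.
Proof.
intros Hxy.
(* Plain [MVT_gen] may return an end point; subtracting half of the quadratic lower bound keeps strictness. *)
destruct (MVT_gen (fun u => f u - m / 2 * (u - x) ^ 2) x y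
            (fun u => f' u - m * (u - x))) as [t [Ht Et]].
- intros t _.
  auto_derive; [now exists (f' t)|].
  rewrite (is_derive_unique (fun u : R => f u) t _ (f_derive t)); field.
- intros t _; apply continuity_pt_filterlim.
  apply (ex_derive_continuous (fun u => f u - m / 2 * (u - x) ^ 2) t).
  auto_derive; now exists (f' t).
- simpl in Et.
  assert (Hsq : 0 < m * ((y - x) * (y - x))).
  { apply Rmult_lt_0_compat; [assumption|].
    apply Rsqr_pos_lt; lra. }
  destruct (Rle_or_lt x y) as [Hle|Hlt].
  + rewrite Rmin_left, Rmax_right in Ht by lra.
    pose proof (derivative_growth x t ltac:(lra)); nra.
  + rewrite Rmin_right, Rmax_left in Ht by lra.
    pose proof (derivative_growth t x ltac:(lra)); nra.
Qed.

Lemma strictly_convex (D : R -> Prop) : strictly_convex_on D f.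
Proof.
intros x y t _ _ Hxy Ht.
set (z := t * x + (1 - t) * y).
assert (Hx : f z + f' z * (x - z) < f x).
{ apply above_tangent; unfold z; intros E.
  apply Hxy; apply (Rmult_eq_reg_l (1 - t)); lra. }
assert (Hy : f z + f' z * (y - z) < f y).
{ apply above_tangent; unfold z; intros E.
  apply Hxy; apply (Rmult_eq_reg_l t); lra. }
(* Both tangent bounds are taken at [z], so their slope terms cancel when weighted by [t] and
   [1 - t]. *)
assert (Hc : t * (f' z * (x - z)) + (1 - t) * (f' z * (y - z)) = 0)
  by (unfold z; ring).
nra.
Qed.

Lemma critical_point : exists z, f' z = 0.
Proof.
(* Growth at rate at least [m] over a length [r] exceeds |f' 0|, which forces a sign change of [f']
   on [-r, r]. *)
set (r := (Rabs (f' 0) + 1) / m).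
assert (Hr : m * r = Rabs (f' 0) + 1) by (unfold r; field; lra).
assert (Hr0 : 0 < r).
{ apply Rdiv_lt_0_compat; [|assumption].
  pose proof (Rabs_pos (f' 0)); lra. }
pose proof (derivative_growth 0 r ltac:(lra)).
pose proof (derivative_growth (- r) 0 ltac:(lra)).
pose proof (Rle_abs (f' 0)).
pose proof (Rle_abs (- f' 0)) as HN; rewrite Rabs_Ropp in HN.
destruct (IVT f' (- r) r) as [z [_ Hz]]; [|lra|lra|lra|now exists z].
intros x; apply continuity_pt_filterlim.
apply (ex_derive_continuous f' x); now exists (f'' x).
Qed.

Lemma gradient_step_contraction eta x y : 0 < eta < 1 / M ->
  Rabs ((x - eta * f' x) - (y - eta * f' y)) <= (1 - eta * m) * Rabs (x - y).
Proof.
intros [Heta HetaM].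
pose proof (f''_bounds 0).
assert (HM : eta * M < 1).
{ apply (Rmult_lt_compat_r M) in HetaM; [|lra].
  replace (1 / M * M) with 1 in HetaM by (field; lra); assumption. }
assert (Hle : forall u v, v <= u ->
  Rabs ((u - eta * f' u) - (v - eta * f' v)) <= (1 - eta * m) * Rabs (u - v)).
{ intros u v Huv.
  pose proof (derivative_growth v u Huv) as [Hm HMu].
  apply (Rmult_le_compat_l eta) in Hm; [|lra].
  apply (Rmult_le_compat_l eta) in HMu; [|lra].
  rewrite !Rabs_pos_eq; nra. }
destruct (Rle_or_lt y x) as [Hyx|Hxy]; [now apply Hle|].
rewrite Rabs_minus_sym, (Rabs_minus_sym x y); apply Hle; lra.
Qed.

Section ConstrainedMinimum.
(** Abstracting the projection [P] and the first-order optimality of [xstar] treats the line and the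
    half-line together. *)
Variables (D : R -> Prop) (P : R -> R) (xstar : R).
Hypothesis P_nonexpansive : forall x y, Rabs (P x - P y) <= Rabs (x - y).
Hypothesis D_xstar : D xstar.
Hypothesis variational_ineq : forall y, D y -> 0 <= f' xstar * (y - xstar).
Hypothesis xstar_fixed : forall eta, 0 < eta -> P (xstar - eta * f' xstar) = xstar.

Lemma unique_minimizer : unique (global_minimizer_on D f) xstar.
Proof.
split.
- split; [assumption|]; intros y Hy.
  destruct (Req_dec xstar y) as [<-|Hne]; [lra|].
  pose proof (above_tangent _ _ Hne); pose proof (variational_ineq y Hy); lra.
- intros y [Hy Hmin].
  destruct (Req_dec xstar y) as [E|Hne]; [assumption|exfalso].
  pose proof (above_tangent _ _ Hne); pose proof (variational_ineq y Hy).
  pose proof (Hmin xstar D_xstar); lra.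
Qed.

Lemma descent_geometric eta x0 n : 0 < eta < 1 / M ->
  Rabs (gradient_descent P f eta x0 n - xstar)
    <= (1 - eta * m) ^ n * Rabs (x0 - xstar).
Proof.
intros Heta.
induction n as [|n IH]; [simpl; lra|].
cbn [gradient_descent]; set (x := gradient_descent P f eta x0 n) in *.
rewrite (is_derive_unique _ _ _ (f_derive x)).
(* Writing [xstar] as its own projected step turns the error into a difference of two steps. *)
rewrite <- (xstar_fixed eta) at 1 by lra.
eapply Rle_trans; [apply P_nonexpansive|].
eapply Rle_trans; [now apply gradient_step_contraction|].
rewrite <- tech_pow_Rmult, Rmult_assoc.
apply Rmult_le_compat_l; [|exact IH].
(* At two points one unit apart the contraction bound reads [0 <= 1 - eta * m]. *)
pose proof (gradient_step_contraction eta 1 0 Heta) as Hc.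
rewrite Rminus_0_r, Rabs_R1, Rmult_1_r in Hc.
eapply Rle_trans; [apply Rabs_pos|exact Hc].
Qed.

Lemma descent_converges : gradient_descent_converges D P f xstar.
Proof.
pose proof (f''_bounds 0).
exists (1 / M); split; [apply Rdiv_lt_0_compat; lra|].
intros eta x0 Heta _.
assert (Hq : Rabs (1 - eta * m) < 1).
{ destruct Heta as [Heta HetaM].
  apply (Rmult_lt_compat_r M) in HetaM; [|lra].
  replace (1 / M * M) with 1 in HetaM by (field; lra).
  apply Rabs_def1; nra. }
apply is_lim_seq_spec; intros eps.
assert (Hlim : is_lim_seq (fun n => (1 - eta * m) ^ n * Rabs (x0 - xstar)) 0).
{ replace (Finite 0) with (Rbar_mult 0 (Rabs (x0 - xstar)))
    by (simpl; f_equal; ring).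
  apply is_lim_seq_scal_r, is_lim_seq_geom; assumption. }
apply is_lim_seq_spec in Hlim.
destruct (Hlim eps) as [N HN]; exists N; intros n Hn.
eapply Rle_lt_trans; [now apply descent_geometric|].
specialize (HN n Hn); rewrite Rminus_0_r in HN.
eapply Rle_lt_trans; [apply Rle_abs|exact HN].
Qed.

End ConstrainedMinimum.

Lemma real_line_minimization : exists x,
  unique (global_minimizer_on real_line f) x /\
  gradient_descent_converges real_line (fun x => x) f x.
Proof.
destruct critical_point as [z Hz]; exists z; split.
- apply unique_minimizer; [exact I|].
  intros y _; rewrite Hz; lra.
- apply descent_converges; [intros; lra|].
  intros eta _; rewrite Hz; ring.
Qed.

Lemma half_line_minimization : exists x,
  unique (global_minimizer_on half_line f) x /\
  gradient_descent_converges half_line (Rmax 0) f x.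
Proof.
destruct critical_point as [z Hz]; exists (Rmax 0 z).
(* Complementarity conditions of the constrained problem. *)
assert (Hopt : 0 <= f' (Rmax 0 z) /\ f' (Rmax 0 z) * Rmax 0 z = 0).
{ destruct (Rle_or_lt 0 z) as [H0z|Hz0].
  - rewrite Rmax_right, Hz by lra; lra.
  - rewrite Rmax_left by lra.
    pose proof (derivative_growth z 0 ltac:(lra)); nra. }
pose proof (Rmax_l 0 z) as Hpos.
destruct Hopt as [Hg Hcompl]; split.
- apply unique_minimizer; [exact Hpos|].
  (* By complementarity the product reduces to [f' (Rmax 0 z) * y], with both factors
     nonnegative. *)
  intros y Hy; unfold half_line in Hy; nra.
- apply descent_converges.
  + intros x y; unfold Rmax; destruct (Rle_dec 0 x), (Rle_dec 0 y);
      unfold Rabs; repeat destruct Rcase_abs; lra.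
  + intros eta Heta.
    (* Either the gradient vanishes, or the minimizer is 0 and the step moves left, where the
       projection brings it back. *)
    destruct (Rmult_integral _ _ Hcompl) as [E|E]; rewrite E.
    * rewrite Rmult_0_r, Rminus_0_r; now apply Rmax_right.
    * rewrite E in Hg; apply Rmax_left; nra.
Qed.

End StronglyConvex.

(** * The logistic function and the derivatives of the objective *)

Lemma sigmoid_bounds z : 0 < sigmoid z < 1.
Proof.
unfold sigmoid; pose proof (exp_pos (- z)); split.
- apply Rdiv_lt_0_compat; lra.
- apply (Rmult_lt_reg_r (1 + exp (- z))); [lra|].
  field_simplify; lra.
Qed.

Lemma is_derive_sigmoid z : is_derive sigmoid z (sigmoid z * (1 - sigmoid z)).
Proof.
unfold sigmoid; pose proof (exp_pos (- z)).
auto_derive; [lra|field; lra].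
Qed.

Lemma sigmoid_second_derivative_bounds z :
  let s := sigmoid z in - (1 / 4) <= s * (1 - s) * (1 - 2 * s) <= 1 / 4.
Proof.
intros s; pose proof (sigmoid_bounds z) as Hs; fold s in Hs.
(* [s * (1 - s) = 1 / 4 - (s - 1 / 2) ^ 2], and the remaining factor [1 - 2 * s] lies in (-1, 1). *)
assert (Hq : 0 <= s * (1 - s) <= 1 / 4)
  by (split; [nra|pose proof (Rle_0_sqr (s - 1 / 2)) as E; unfold Rsqr in E; lra]).
nra.
Qed.

Section ObjectiveDerivatives.
Variables (Query : Type) (Hpref : R -> Query -> R) (a b c alpha lambda C : R) (Q : Query).

Let s H := sigmoid (a * (H - Hpref C Q) - b * C + c).

Lemma is_derive_sigmoid_score H : is_derive s H (a * (s H * (1 - s H))).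
Proof.
apply (is_derive_comp sigmoid); [apply is_derive_sigmoid|].
auto_derive; [exact I|ring].
Qed.

Let L' H := 2 * alpha * (H - Hpref C Q) + lambda * (a * (s H * (1 - s H))).

Lemma is_derive_L_total H :
  is_derive (L_total Hpref a b c alpha lambda C Q) H (L' H).
Proof.
change (is_derive (fun H => alpha * (H - Hpref C Q) ^ 2 + lambda * s H) H (L' H)).
pose proof (is_derive_sigmoid_score H) as Hs.
auto_derive; [now eexists; apply Hs|].
rewrite (is_derive_unique (fun x : R => s x) H _ Hs); unfold L'; ring.
Qed.

Lemma is_derive_L_total' H :
  is_derive L' H
    (2 * alpha + lambda * a ^ 2 * (s H * (1 - s H) * (1 - 2 * s H))).
Proof.
pose proof (is_derive_sigmoid_score H) as Hs.
(* With [s] opaque, [auto_derive] keeps its derivative abstract and [Hs] supplies it. *)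
unfold L'; clearbody s.
auto_derive; [repeat split; now eexists; apply Hs|].
rewrite (is_derive_unique (fun x : R => s x) H _ Hs); ring.
Qed.

End ObjectiveDerivatives.

(** Both readings of the domain are covered: entropies [H >= 0] with projected descent, and the
    whole line with plain descent. The minimizers differ when the critical point is negative. *)
Theorem theorem4 :
  forall (Query : Type) (Hpref : R -> Query -> R) (a b c alpha lambda : R),
    0 < a -> 0 < b -> 0 < alpha -> 0 < lambda ->
    alpha > lambda * a ^ 2 / 8 ->
    forall (C : R) (Q : Query),
      let L := L_total Hpref a b c alpha lambda C Q in
      (strictly_convex_on half_line L /\
       exists Hstar : R,
         unique (global_minimizer_on half_line L) Hstar /\
         gradient_descent_converges half_line (Rmax 0) L Hstar) /\
      (strictly_convex_on real_line L /\
       exists Hstar : R,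
         unique (global_minimizer_on real_line L) Hstar /\
         gradient_descent_converges real_line (fun x => x) L Hstar).
Proof.
intros Query Hpref a b c alpha lambda Ha _ _ Hlambda Halpha C Q L.
pose proof (is_derive_L_total Query Hpref a b c alpha lambda C Q) as HL.
pose proof (is_derive_L_total' Query Hpref a b c alpha lambda C Q) as HL'.
cbv zeta in HL, HL'.
(* The threshold on [alpha] is exactly positivity of this lower curvature bound. *)
assert (Hm : 0 < 2 * alpha - lambda * a ^ 2 / 4) by lra.
assert (Hbounds : forall H,
  let s := sigmoid (a * (H - Hpref C Q) - b * C + c) in
  2 * alpha - lambda * a ^ 2 / 4
    <= 2 * alpha + lambda * a ^ 2 * (s * (1 - s) * (1 - 2 * s))
    <= 2 * alpha + lambda * a ^ 2 / 4).
{ intros H s.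
  pose proof (sigmoid_second_derivative_bounds
                (a * (H - Hpref C Q) - b * C + c)) as Hs; fold s in Hs.
  assert (Hk : 0 < lambda * a ^ 2)
    by (apply Rmult_lt_0_compat; [assumption|now apply pow_lt]).
  cbv zeta in Hs; nra. }
cbv zeta in Hbounds.
split; split.
- exact (strictly_convex _ _ _ _ _ HL HL' Hm Hbounds _).
- exact (half_line_minimization _ _ _ _ _ HL HL' Hm Hbounds).
- exact (strictly_convex _ _ _ _ _ HL HL' Hm Hbounds _).
- exact (real_line_minimization _ _ _ _ _ HL HL' Hm Hbounds).
Qed.
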